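(* Let $X$ be a transitive shift space over a finite or countable alphabet that has a synchronizing word $v$, and let $r\colon X\to(0,\infty)$ be a roof function satisfying the Walters property. Then the suspension flow over $(X,\sigma)$ with roof function $r$ is not topologically mixing if and only if there exists a $\delta>0$ such that for every periodic point $p\in[v]$ we have $$\sum_{j=0}^{\mathrm{per}(p)-1} r(\sigma^j p)\in\delta\mathbb{Z},$$ where $\mathrm{per}(p)$ is the period of $p$ under the shift map $\sigma$.
   Context: Let $A$ be a finite or countable set (alphabet). $A^{\mathbb{Z}}$ has the metric $d(x,y)=2^{-\min\{|n|: x_n\neq y_n\}}$ (and $d(x,x)=0$), and $\sigma\colon A^{\mathbb{Z}}\to A^{\mathbb{Z}}$ is the left shift $(\sigma x)_n=x_{n+1}$. A shift space is a nonempty closed $\sigma$-invariant ($\sigma(X)=X$) set $X\subset A^{\mathbb{Z}}$. For $x \in A^{\mathbb Z}$, $x_{[i,j]}=x_i\cdots x_j$ and $x_{[i,j)}=x_i\cdots x_{j-1}$. The language $\mathcal{L}$ of $X$ is the set of all finite words appearing in some $x\in X$. $X$ is transitive if for all $u,v\in\mathcal{L}$ there is $w\in\mathcal{L}$ with $uwv\in\mathcal{L}$. A word $v\in\mathcal{L}$ is synchronizing if whenever $u,w\in\mathcal{L}$ satisfy $uv\in\mathcal{L}$ and $vw\in\mathcal{L}$, then $uvw\in\mathcal{L}$. Cylinders are centered: $[w]=\{x\in X: x_{[-n,n]}=w\}$ if $|w|=2n+1$, and $[w]=\{x\in X: x_{[-n,n)}=w\}$ if $|w|=2n$. A function $r\colon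 X\to\mathbb{R}$ satisfies the Walters property if for every $\varepsilon>0$ there is $k\ge 0$ such that for all $n\in\mathbb{N}$ and all $x,y\in X$ with $x_{[-k,n+k]}=y_{[-k,n+k]}$ we have $\left|\sum_{j=0}^{n-1}\big(r(\sigma^jx)-r(\sigma^jy)\big)\right|<\varepsilon$. Suspension flow: given $r\colon X\to(0,\infty)$, let $M_r=\{(x,t)\in X\times[0,\infty): 0\le t\le r(x)\}/\sim$, with the quotient topology, where $(x,r(x))\sim(\sigma x,0)$. The suspension flow is $\varphi^T(x,s)=(\sigma^n x,s')$, where $n$ and $s'$ satisfy $\sum_{j=0}^{n-1}r(\sigma^jx)+s'=T+s$ and $0\le s'\le r(\sigma^nx)$. It is topologically mixing if for all nonempty open $U,V\subset M_r$ there is $T\in\mathbb{R}$ such that $\varphi^t(U)\cap V\neq\emptyset$ for all $t\ge T$. *)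

(* Defs.v *)
From HB Require Import structures.
From Stdlib Require Import Relations.
From mathcomp Require Import all_boot all_order all_algebra generic_quotient.
From mathcomp Require Import all_classical all_reals all_analysis.

Set Implicit Arguments.
Unset Strict Implicit.
Unset Printing Implicit Defensive.

Import Order.TTheory GRing.Theory Num.Theory.
Import numFieldNormedType.Exports.

Local Open Scope classical_set_scope.
Local Open Scope ring_scope.
Local Open Scope quotient_scope.

(* The real field R is a parameter of the alias only so that the canonical
   metric of A^Z can take its values in R. *)
Definition fullshift (R : realType) (A : countType) : Type := int -> A.

HB.instance Definition _ (R : realType) (A : countType) :=
  Choice.copy (fullshift R A) (int -> A).

Section Metric.
Context {R : realType} {A : countType}.
Implicit Types x y z : fullshift R A.

Definition differ_at x y : pred nat :=
  fun m => `[< exists n : int, `|n|%N = m /\ x n <> y n >].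

(* 2 ^- min {|n| : x_n != y_n}, and 0 when there is no such n *)
Definition shift_dist x y : R :=
  if pselect (exists m, differ_at x y m) is left h then 2 ^- ex_minn h else 0.

Lemma shift_dist_lb x y (n : int) : x n <> y n -> 2 ^- `|n|%N <= shift_dist x y.
Proof.
move=> xyn; have Pn : differ_at x y `|n|%N by apply/asboolP; exists n.
rewrite /shift_dist; case: pselect => [h|[]]; last by exists `|n|%N.
case: ex_minnP => m _ /(_ _ Pn) mn.
by rewrite lef_pV2 ?posrE ?exprn_gt0// ler_weXn2l// ler1n.
Qed.

Lemma shift_distP x y :
  shift_dist x y = 0 \/
  exists2 n : int, x n <> y n & shift_dist x y = 2 ^- `|n|%N.
Proof.
rewrite /shift_dist; case: pselect => [h|_]; last by left.
by right; case: ex_minnP => m /asboolP[n [<- xyn]] _; exists n.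
Qed.

Lemma shift_dist_ge0 x y : 0 <= shift_dist x y.
Proof. by case: (shift_distP x y) => [->//|[n _ ->]]; rewrite invr_ge0 exprn_ge0. Qed.

Lemma shift_distxx x : shift_dist x x = 0.
Proof. by case: (shift_distP x x) => [//|[n /(_ erefl)]]. Qed.

Lemma shift_dist_eq0 x y : shift_dist x y = 0 -> x = y.
Proof.
move=> d0; apply/funext => n; apply: contrapT => /shift_dist_lb.
by rewrite d0 leNgt invr_gt0 exprn_gt0.
Qed.

Lemma shift_dist_sym x y : shift_dist x y = shift_dist y x.
Proof.
wlog suff : x y / shift_dist x y <= shift_dist y x.
  by move=> H; apply/eqP; rewrite eq_le !H.
case: (shift_distP x y) => [->|[n xyn ->]]; first exact: shift_dist_ge0.
by apply: shift_dist_lb => /esym.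
Qed.

Lemma shift_dist_triangle y x z :
  shift_dist x z <= shift_dist x y + shift_dist y z.
Proof.
case: (shift_distP x z) => [->|[n xzn ->]].
  by rewrite addr_ge0// shift_dist_ge0.
have [xyn|/shift_dist_lb xyn] := pselect (x n = y n).
  by apply: ler_wpDl (shift_dist_ge0 _ _) _; apply: shift_dist_lb; rewrite -xyn.
by apply: ler_wpDr (shift_dist_ge0 _ _) xyn.
Qed.

HB.instance Definition _ := @isMetric.Build R (fullshift R A) shift_dist
  shift_distxx shift_dist_eq0 shift_dist_sym shift_dist_triangle.

End Metric.

Section Shift.
Context {R : realType} {A : countType}.
Implicit Types (x y p : fullshift R A) (X : set (fullshift R A)).
Implicit Types (r : fullshift R A -> R) (u v w : seq A).

(* sigma ^ n for n in Z *)
Definition shift_pow (n : int) x : fullshift R A := fun i => x (i + n).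

Definition left_shift x : fullshift R A := shift_pow 1 x.

Definition shift_space X := [/\ X !=set0, closed X & left_shift @` X = X].

(* the word x_[i, i + n) *)
Definition block x (i : int) (n : nat) : seq A :=
  [seq x (i + k%:Z) | k <- iota 0 n].

Definition language X : set (seq A) :=
  [set w | exists2 x, X x & exists i, block x i (size w) = w].

Definition transitive_shift X := forall u v,
  language X u -> language X v ->
  exists2 w, language X w & language X (u ++ w ++ v).

Definition synchronizing X v := language X v /\
  forall u w, language X u -> language X w ->
    language X (u ++ v) -> language X (v ++ w) -> language X (u ++ v ++ w).

(* Since (2n+1)./2 = (2n)./2 = n, the position of w is [-n, n] if
   size w = 2n+1, and [-n, n) if size w = 2n. *)
Definition cylinder X w : set (fullshift R A) :=
  [set x | X x /\ block x (- (size w)./2%:Z) (size w) = w].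

(* block _ (- k) (n + k.*2).+1 is the word on the interval [-k, n + k] *)
Definition walters X r := forall e : R, 0 < e -> exists k : nat,
  forall (n : nat) x y, X x -> X y ->
    block x (- k%:Z) (n + k.*2).+1 = block y (- k%:Z) (n + k.*2).+1 ->
    `| \sum_(j < n) (r (shift_pow j%:Z x) - r (shift_pow j%:Z y)) | < e.

Definition is_period p : pred nat :=
  fun n => (0 < n)%N && `[< shift_pow n%:Z p = p >].

Definition periodic_pt p := exists n, is_period p n.

(* the least period of a periodic point; 0 if p is not periodic *)
Definition per p : nat :=
  if pselect (periodic_pt p) is left h then ex_minn h else 0%N.

(* The sum of r (sigma^j x) over 0 <= j < n, with the usual cocycle convention
   - (r (sigma^n x) + ... + r (sigma^-1 x)) for n < 0. *)
Definition birkhoff_sum r (n : int) x : R :=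
  match n with
  | Posz m => \sum_(j < m) r (shift_pow j%:Z x)
  | Negz m => - \sum_(j < m.+1) r (shift_pow (- j.+1%:Z) x)
  end.

End Shift.

Section Suspension.
Context {R : realType} {A : countType}.
Variables (X : set (fullshift R A)) (r : fullshift R A -> R).

Definition under_roof : set (fullshift R A * R) :=
  [set q | X q.1 /\ 0 <= q.2 <= r q.1].

Definition susp_glue (a b : set_type under_roof) : Prop :=
  [/\ (\val a).2 = r (\val a).1, (\val b).1 = left_shift (\val a).1
    & (\val b).2 = 0].

Definition susp_rel (a b : set_type under_roof) : bool :=
  `[< clos_refl_sym_trans _ susp_glue a b >].

Lemma susp_rel_refl : reflexive susp_rel.
Proof. by move=> a; apply/asboolP; exact: rst_refl. Qed.

Lemma susp_rel_sym : symmetric susp_rel.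
Proof. by move=> a b; apply/asboolP/asboolP; exact: rst_sym. Qed.

Lemma susp_rel_trans : transitive susp_rel.
Proof. by move=> b a c /asboolP ab /asboolP bc; apply/asboolP; exact: rst_trans bc. Qed.

Canonical susp_equiv := EquivRel susp_rel susp_rel_refl susp_rel_sym susp_rel_trans.

Definition suspension : topologicalType :=
  quotient_topology {eq_quot susp_equiv}.

Definition susp_pi (a : set_type under_roof) : suspension :=
  \pi_{eq_quot susp_equiv} a.

(* phi^T as a relation. As r need not be bounded away from 0, the Birkhoff sums
   along an orbit may converge, and then phi^T is undefined for large |T|. *)
Definition susp_flow (T : R) (a b : suspension) : Prop :=
  exists a' b' : set_type under_roof,
    [/\ susp_pi a' = a, susp_pi b' = b &
      exists2 n : int, (\val b').1 = shift_pow n (\val a').1 &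
        birkhoff_sum r n (\val a').1 + (\val b').2 = T + (\val a').2].

Definition susp_flow_image (T : R) (U : set suspension) : set suspension :=
  [set b | exists2 a, U a & susp_flow T a b].

Definition topologically_mixing := forall U V : set suspension,
  open U -> open V -> U !=set0 -> V !=set0 ->
  exists T : R, forall t, T <= t -> susp_flow_image t U `&` V !=set0.

End Suspension.

(* Main.v *)
Require Import Defs.
From Stdlib Require Import Relations.
From mathcomp Require Import all_boot all_order all_algebra generic_quotient.
From mathcomp Require Import all_classical all_reals all_analysis.
From mathcomp Require Import zify ring lra.

(* If all periodic orbits through [v] have length in delta Z, then an orbit
   segment that leaves and re-enters a small neighbourhood of a point of [v] is
   shadowed by a periodic orbit through [v], so by the Walters property its
   return times lie near delta Z, and the neighbourhood misses itself at the
   times (M + 1/2) delta. Conversely, if no delta works, then for every eta two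
   periodic orbits p, q through [v] have lengths a, b with an integer
   combination in (0, eta), so the numbers i a + j b are eventually eta-dense.
   Since v is synchronizing, one can go from U into [v], follow p for i periods,
   then q for j periods, and then go to V; up to a small error the travel time
   is C + i a + j b with C independent of i and j. *)

Set Implicit Arguments.
Unset Strict Implicit.
Unset Printing Implicit Defensive.

Import Order.TTheory GRing.Theory Num.Theory.
Import numFieldNormedType.Exports.

Local Open Scope classical_set_scope.
Local Open Scope ring_scope.

(** * Splicing points along a synchronizing word *)

Section Shift.
Context {R : realType} {A : countType}.
Implicit Types (x y z p : fullshift R A) (X : set (fullshift R A)).
Implicit Types (r : fullshift R A -> R) (u v w : seq A).

Lemma size_block x i n : size (block x i n) = n.
Proof. by rewrite size_map size_iota. Qed.

Lemma block_eqP x y i j n :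
  block x i n = block y j n <-> forall k, (k < n)%N -> x (i + k%:Z) = y (j + k%:Z).
Proof.
split=> [/eq_in_map + k kn|H]; first by apply; rewrite mem_iota.
by apply/eq_in_map => k; rewrite mem_iota add0n => /andP[_]; exact: H.
Qed.

Lemma block_cat x i n m :
  block x i (n + m) = block x i n ++ block x (i + n%:Z) m.
Proof.
rewrite /block iotaD map_cat add0n; congr (_ ++ _).
rewrite -{1}[n]addn0 iotaDl -map_comp; apply: eq_map => k /=.
by rewrite PoszD addrA.
Qed.

Lemma language_block X x i n : X x -> language X (block x i n).
Proof. by move=> Xx; exists x => //; exists i; rewrite size_block. Qed.

Lemma shift_powD m n x : shift_pow m (shift_pow n x) = shift_pow (m + n) x.
Proof. by apply/funext => i; rewrite /shift_pow addrA. Qed.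

Lemma shift_pow0 x : shift_pow 0 x = x.
Proof. by apply/funext => i; rewrite /shift_pow addr0. Qed.

Lemma shift_pow_mem X n x : shift_space X -> X x -> X (shift_pow n x).
Proof.
move=> [_ _ sX].
have sX1 y : X y -> X (shift_pow 1 y) by move=> Xy; rewrite -sX; exists y.
have sXN1 y : X y -> X (shift_pow (-1) y).
  by rewrite -{1}sX => -[z Xz <-]; rewrite shift_powD shift_pow0.
elim/int_ind: n x => [|n IH|n IH] x Xx.
- by rewrite shift_pow0.
- by rewrite (_ : n.+1%:Z = 1 + n%:Z) -?shift_powD; [exact/sX1/IH|lia].
- by rewrite (_ : - n.+1%:Z = - 1 + - n%:Z) -?shift_powD; [exact/sXN1/IH|lia].
Qed.

Definition agree (m : nat) x y := forall i : int, (`|i| <= m)%N -> x i = y i.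


Lemma agreeP m x y : agree m x y <-> shift_dist x y < 2 ^- m.
Proof.
split=> [xy|xy i im]; last first.
  apply: contrapT => /shift_dist_lb; apply/negP; rewrite -ltNge.
  by apply: lt_le_trans xy _; rewrite lef_pV2 ?posrE ?exprn_gt0// ler_weXn2l// ler1n.
case: (shift_distP x y) => [->|[n xyn ->]]; first by rewrite invr_gt0 exprn_gt0.
rewrite ltf_pV2 ?posrE ?exprn_gt0// ltr_eXn2l ?ltr1n// ltnNge.
by apply/negP => /xy.
Qed.

Lemma nbhs_agree x (U : set (fullshift R A)) :
  nbhs x U <-> exists m, forall y, agree m x y -> U y.
Proof.
split=> [/nbhs_ballP[e e0 eU]|[m mU]].
  have [m me] : exists m : nat, 2 ^- m < e.
    have [m _ /(_ m (leqnn m))] := @near_infty_natSinv_expn_lt R (PosNum e0).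
    by rewrite /= div1r; exists m.
  exists m => y /agreeP xy; apply: eU; rewrite ballEmdist /=.
  exact: lt_trans xy me.
apply/nbhs_ballP; exists (2 ^- m) => /=; first by rewrite invr_gt0 exprn_gt0.
by move=> y; rewrite ballEmdist => xy; apply: mU; exact/agreeP.
Qed.

Lemma closed_agree X x : closed X ->
  (forall m, exists2 y, X y & agree m x y) -> X x.
Proof.
move=> cX H; apply: cX => U /nbhs_agree[m mU].
by have [y Xy xy] := H m; exists y; split=> //; exact: mU.
Qed.

Definition splice x y : fullshift R A := fun i => if i < 0 then x i else y i.

(** The cut at 0 falls within the common centered copy of [v], so the splice follows [x] up to the
    right end of [v] and [y] from its left end on. *)
Lemma spliceE X v x y (i : int) : cylinder X v x -> cylinder X v y ->
  (i < (size v)%:Z - (size v)./2%:Z -> splice x y i = x i) /\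
  (- (size v)./2%:Z <= i -> splice x y i = y i).
Proof.
move=> [_ xv] [_ yv].
have xy (j : int) : - (size v)./2%:Z <= j < (size v)%:Z - (size v)./2%:Z ->
    x j = y j.
  move=> jv; have /block_eqP/(_ `|(j + (size v)./2%:Z)%R|%N) := etrans xv (esym yv).
  by rewrite (_ : - _ + _ = j); [apply; lia | lia].
rewrite /splice; case: ifPn => i0; split=> // iv; first by apply: xy; lia.
by apply/esym/xy; lia.
Qed.

(** Synchronization joins a block of [x] ending in [v] to a block of [y] beginning with [v]. The
    joined words realize arbitrarily long central blocks of the splice inside [X], and [X] is
    closed. *)
Lemma splice_cylinder X v x y : shift_space X -> synchronizing X v ->
  cylinder X v x -> cylinder X v y -> cylinder X v (splice x y).
Proof.
move=> sX [Lv syn] Cx Cy; have [[Xx xv] [Xy yv]] := (Cx, Cy).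
have spl i := spliceE i Cx Cy.
split; last first.
  rewrite -[RHS]xv; apply/block_eqP => k kv; apply: (spl _).1; lia.
case: (sX) => _ cX _; apply: closed_agree cX _ => m.
set h := (size v)./2 in spl xv yv *.
pose M := (m + size v)%N.
pose u := block x (- M%:Z) (M - h).
pose w := block y ((size v)%:Z - h%:Z) (M - (size v - h)).+1.
have hv : (h <= size v)%N by rewrite /h; lia.
have uvE : u ++ v = block x (- M%:Z) (M - h + size v).
  rewrite block_cat -/u -[in LHS]xv; congr (_ ++ block _ _ _); lia.
have vwE : v ++ w = block y (- h%:Z) (size v + (M - (size v - h)).+1).
  rewrite block_cat yv /w; congr (_ ++ block _ _ _); lia.
have : language X (u ++ v ++ w).
  apply: syn; rewrite ?uvE ?vwE; exact: language_block.
case=> z Xz [i zi].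
exists (shift_pow (i + M%:Z) z); first exact: shift_pow_mem.
move=> j jm; rewrite /shift_pow.
have su : size (u ++ v) = (M - h + size v)%N by rewrite uvE size_block.
have sz : size (u ++ v ++ w) = (M - h + size v + (M - (size v - h)).+1)%N.
  by rewrite catA size_cat su size_block.
have zuv : block z i (M - h + size v) = u ++ v.
  move: zi; rewrite sz block_cat catA => /eqP.
  by rewrite eqseq_cat ?size_block// => /andP[/eqP].
have zvw : block z (i + (M - h)%N%:Z) (size v + (M - (size v - h)).+1) = v ++ w.
  move: zi; rewrite sz -addnA block_cat => /eqP.
  by rewrite eqseq_cat ?size_block// => /andP[_ /eqP].
case: (ltP j 0) => j0.
  rewrite (spl j).1; last by lia.
  move: zuv; rewrite uvE => /block_eqP/(_ `|(j + M%:Z)%R|%N) H.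
  rewrite (_ : j + (i + _) = i + `|(j + M%:Z)%R|%N%:Z); last by lia.
  rewrite H; last by lia.
  by congr x; lia.
rewrite (spl j).2; last by lia.
move: zvw; rewrite vwE => /block_eqP/(_ `|(j + h%:Z)%R|%N) H.
rewrite (_ : j + (i + _) = i + (M - h)%N%:Z + `|(j + h%:Z)%R|%N%:Z); last by lia.
rewrite H; last by lia.
by congr y; lia.
Qed.

End Shift.

(** * Birkhoff sums and periodic orbits *)

Section Sums.
Context {R : realType} {A : countType}.
Implicit Types (x y z p : fullshift R A) (X : set (fullshift R A)).
Implicit Types (r : fullshift R A -> R) (u v w : seq A).

Lemma cylinder_ext X v x y : cylinder X v x -> X y ->
  (forall i : int, - (size v)./2%:Z <= i < (size v)%:Z - (size v)./2%:Z ->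
     y i = x i) ->
  cylinder X v y.
Proof.
move=> [_ xv] Xy yx; split=> //; rewrite -[RHS]xv.
by apply/block_eqP => k kv; apply: yx; lia.
Qed.

Definition bsum r x (s : int) (n : nat) : R :=
  \sum_(j < n) r (shift_pow (s + j%:Z) x).

Lemma bsumD r x s m n : bsum r x s (m + n) = bsum r x s m + bsum r x (s + m%:Z) n.
Proof.
rewrite /bsum big_split_ord; congr (_ + _); apply: eq_bigr => j _ /=.
by rewrite PoszD addrA.
Qed.

Lemma bsum_shift r x t s n : bsum r (shift_pow t x) s n = bsum r x (s + t) n.
Proof. by apply: eq_bigr => j _; rewrite shift_powD addrAC. Qed.

Lemma bsum0 r x n : bsum r x 0 n = \sum_(j < n) r (shift_pow j%:Z x).
Proof. by apply: eq_bigr => j _; rewrite add0r. Qed.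

(** A form of the Walters property in which the two orbit segments may start at different times, so
    that pieces of spliced orbits can be compared in place. *)
Lemma walters_bsum X r e : shift_space X -> walters X r -> 0 < e ->
  exists k : nat, forall x y s t n, X x -> X y ->
    (forall i : int, - k%:Z <= i <= (n + k)%N%:Z -> x (i + s) = y (i + t)) ->
    `|bsum r x s n - bsum r y t n| < e.
Proof.
move=> sX wr e0; have [k kP] := wr e e0; exists k => x y s t n Xx Xy xy.
have := kP n (shift_pow s x) (shift_pow t y).
rewrite sumrB -!bsum0 !bsum_shift !add0r; apply; try exact: shift_pow_mem.
by apply/block_eqP => j jk; apply: xy; lia.
Qed.

Lemma shift_pow_mul p (n : nat) (l : int) :
  shift_pow n%:Z p = p -> shift_pow (l * n%:Z) p = p.
Proof.
move=> pn.
have H m : shift_pow (m%:Z * n%:Z) p = p.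
  elim: m => [|m IH]; first by rewrite mul0r shift_pow0.
  by rewrite (_ : _ * _ = n%:Z + m%:Z * n%:Z) -?shift_powD ?IH//; lia.
have [l0|l0] := leP 0 l; first by rewrite (_ : l = `|l|%N%:Z) ?H//; lia.
rewrite -{1}(H `|l|%N) shift_powD (_ : _ + _ = 0) ?shift_pow0//; lia.
Qed.

Lemma bsum_mul r p n (l : nat) : shift_pow n%:Z p = p ->
  bsum r p 0 (l * n) = l%:R * bsum r p 0 n.
Proof.
move=> pn; elim: l => [|l IH]; first by rewrite !mul0r /bsum big_ord0.
rewrite mulSn bsumD add0r -[n%:Z]add0r -bsum_shift pn IH.
by rewrite -natr1 mulrDl mul1r addrC.
Qed.

Lemma perP p : periodic_pt p ->
  [/\ (0 < per p)%N, shift_pow (per p)%:Z p = p &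
   forall n, shift_pow n%:Z p = p -> (per p %| n)%N].
Proof.
rewrite /per; case: pselect => // h _; case: ex_minnP => m /andP[m0 /asboolP pm].
move=> min; split=> // n pn; rewrite /dvdn -leqn0 leqNgt; apply/negP => nm.
(* A nonzero remainder would be a period smaller than the least one. *)
have /min : is_period p (n %% m)%N.
  rewrite /is_period nm; apply/asboolP.
  rewrite -[RHS]pn -[in RHS](shift_pow_mul (- (n %/ m)%N%:Z) pm) shift_powD.
  congr (shift_pow _ p); have := divn_eq n m; lia.
by rewrite leqNgt ltn_pmod.
Qed.

Definition periodize (n : nat) x : fullshift R A := fun i => x (i %% n%:Z)%Z.

Lemma periodize_mod n x : shift_pow n%:Z (periodize n x) = periodize n x.
Proof. by apply/funext => i; rewrite /shift_pow /periodize modzDr. Qed.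

(** The segment of [x] on [[0, n)] runs from one copy of [v] to the next, so it can be spliced in
    front of itself any number of times; closedness of [X] gives the periodic limit. *)
Lemma periodize_cylinder X v x n : shift_space X -> synchronizing X v ->
  (0 < n)%N -> cylinder X v x -> cylinder X v (shift_pow n%:Z x) ->
  cylinder X v (periodize n x).
Proof.
move=> sX syn n0 Cx Cnx.
(* [y m] agrees with the periodic point on m periods to the right of 0. *)
have /choice[y yP] : forall m, exists ym, [/\ X ym,
      forall l : nat, (l <= m)%N -> cylinder X v (shift_pow (l * n)%N%:Z ym) &
      forall t : int, 0 <= t < (m * n)%N%:Z -> ym t = periodize n x t].
  elim=> [|m [y [Xy Cy yt]]].
    exists x; split; first by case: Cx.
      by move=> l; rewrite leqn0 => /eqP ->; rewrite mul0n shift_pow0.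
    by move=> t; lia.
  have Cy0 : cylinder X v y by rewrite -[y]shift_pow0; exact: (Cy 0%N).
  have spl i := spliceE i Cnx Cy0.
  have [Xs _] := splice_cylinder sX syn Cnx Cy0.
  have Xy' : X (shift_pow (- n%:Z) (splice (shift_pow n%:Z x) y)).
    exact: shift_pow_mem.
  (* One more copy of the segment goes in front: [x] is cut at its second [v], continued by [y], and
     moved back so that the new copy fills [[0, n)]. *)
  exists (shift_pow (- n%:Z) (splice (shift_pow n%:Z x) y)); split=> //.
    case=> [_|l lm].
      rewrite mul0n shift_pow0; apply: cylinder_ext Cx Xy' _ => i iv.
      rewrite /shift_pow (spl _).1 ?/shift_pow; first by congr x; lia.
      lia.
    rewrite shift_powD (_ : _ + _ = (l * n)%N%:Z); last by lia.
    apply: cylinder_ext (Cy l lm) _ _; first exact: shift_pow_mem.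
    by move=> i iv; rewrite /shift_pow (spl _).2//; lia.
  move=> t tm; rewrite /shift_pow; have [tn|tn] := ltP t n%:Z.
    rewrite (spl _).1 /shift_pow ?/periodize; last by lia.
    by rewrite modz_small ?subrK//; lia.
  rewrite (spl _).2; last by lia.
  rewrite yt; last by lia.
  by rewrite /periodize -[t in RHS](subrK n%:Z) modzDr.
(* Of the [2m+1] good periods, [m] are moved to the left of 0; what is left covers
   [[- m n, (m+1) n)], which contains [[-m, m]]. *)
have ag m : agree m (periodize n x) (shift_pow (m * n)%N%:Z (y m.*2.+1)).
  move=> i im; have [_ _ yt] := yP m.*2.+1.
  rewrite /shift_pow yt ?/periodize; last by nia.
  by rewrite PoszM addrC modzMDl.
have Xp : X (periodize n x).
  case: (sX) => _ cX _; apply: closed_agree cX _ => m.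
  exists (shift_pow (m * n)%N%:Z (y m.*2.+1)) => //.
  by apply: shift_pow_mem => //; case: (yP m.*2.+1).
have [_ Cy _] := yP (size v).*2.+1.
apply: cylinder_ext (Cy (size v) _) Xp _; first by lia.
by move=> i iv; apply: ag; lia.
Qed.

Lemma return_time X v r e y : shift_space X -> synchronizing X v -> walters X r ->
  0 < e -> cylinder X v y ->
  exists m : nat, forall x n, X x -> (0 < n)%N -> agree m y x ->
    agree m y (shift_pow n%:Z x) ->
    exists p, [/\ cylinder X v p, shift_pow n%:Z p = p &
      `|bsum r x 0 n - bsum r p 0 n| < e].
Proof.
move=> sX syn wr e0 Cy; have [k kP] := walters_bsum sX wr e0.
(* Radius [k] serves the Walters window, and [size v] puts [v] at both ends of the segment. *)
exists (k + size v)%N => x n Xx n0 yx ynx.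
have Xnx : X (shift_pow n%:Z x) by exact: shift_pow_mem.
have Cx : cylinder X v x.
  by apply: cylinder_ext Cy Xx _ => i iv; rewrite yx//; lia.
have Cnx : cylinder X v (shift_pow n%:Z x).
  by apply: cylinder_ext Cy Xnx _ => i iv; rewrite ynx//; lia.
have Cp := periodize_cylinder sX syn n0 Cx Cnx.
exists (periodize n x); split=> //; first exact: periodize_mod.
apply: kP => //; first by case: Cp.
have xn (i : int) : - k%:Z <= i <= k%:Z -> x i = x (i + n%:Z).
  move=> ik; rewrite -yx; last by lia.
  by rewrite ynx//; lia.
move=> i ik; rewrite !addr0 /periodize.
(* Outside [[0, n)] the index moves by [n] towards that interval; [xn] says that this does not
   change the symbol, because both ends of the segment look like [y] on [[-k, k]]. *)
have [N] := ubnP `|i|%N; elim: N i ik => // N IH i ik iN.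
have [i0|i0] := ltP i 0.
  have [in0|in0] := ltP (i + n%:Z) 0.
    rewrite xn; last by lia.
    by rewrite IH ?modzDr//; lia.
  rewrite -modzDr modz_small; last by lia.
  by apply: xn; lia.
have [ni|ni] := ltP i n%:Z; first by rewrite modz_small//; lia.
rewrite -{1}[i](subrK n%:Z) -xn; last by lia.
rewrite IH; [|by lia|by lia].
by rewrite -[in RHS](subrK n%:Z i) modzDr.
Qed.

End Sums.

(** * Lattice periods prevent mixing *)

Section Susp.
Context {R : realType} {A : countType}.
Context (X : set (fullshift R A)) (r : fullshift R A -> R).

Lemma open_under_roofP (O : set (set_type (under_roof X r))) :
  open O <-> forall a, O a -> exists m (e : R), 0 < e /\ forall b,
    agree m (\val a).1 (\val b).1 -> `|(\val a).2 - (\val b).2| < e -> O b.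
Proof.
split=> [[V oV <-] a Va|H].
  have [[P Q] /= [/nbhs_agree[m mP] /nbhs_ballP[e e0 eQ]] PQ] := open_nbhs_nbhs (conj oV Va).
  exists m, e; split=> // b ab ab2; apply: PQ; split; first exact: mP.
  exact: eQ.
rewrite openE => a /H[m [e [e0 mO]]].
pose V : set (fullshift R A * R) := [set q | agree m (\val a).1 q.1 /\ `|(\val a).2 - q.2| < e].
have V0 : nbhs (\val a : fullshift R A * R) V.
  exists ([set x | agree m (\val a).1 x], ball (\val a).2 e) => /=.
    by split; [apply/nbhs_agree; exists m | exact: nbhsx_ballx].
  by case=> x t [].
have aV : nbhs a (\val @^-1` V) by exact: (@initial_continuous _ _ \val a _ V0).
by apply: filterS aV => b [] /=; exact: mO.
Qed.

Lemma open_susp_piP (U : set (suspension X r)) :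
  open U <-> open (@susp_pi R A X r @^-1` U).
Proof. by []. Qed.

Lemma susp_piP (a b : set_type (under_roof X r)) :
  susp_pi a = susp_pi b <-> clos_refl_sym_trans _ (@susp_glue R A X r) a b.
Proof.
split=> [/eqmodP/asboolP//|ab].
exact/eqmodP/asboolP.
Qed.

(** Gluing only relates a point on the roof to a point on the floor, so the class of a point
    strictly between them is a singleton. *)
Lemma susp_pi_interior (a b : set_type (under_roof X r)) :
  0 < (\val a).2 < r (\val a).1 -> susp_pi a = susp_pi b -> a = b.
Proof.
move=> a0 /susp_piP ab.
pose inner (c : set_type (under_roof X r)) := 0 < (\val c).2 < r (\val c).1.
(* The claim is made symmetric in [a] and [b] so that the induction passes through the symmetry
   case. *)
suff : (inner a -> a = b) /\ (inner b -> a = b) by case=> /(_ a0).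
elim: ab {a0} => {a b} //.
- move=> a b [ha _ hb]; rewrite /inner; split; first by rewrite ha ltxx andbF.
  by rewrite hb ltxx.
- by move=> a b _ [IH1 IH2]; split=> ?; apply/esym; auto.
- move=> a b c _ [ab ba] _ [bc cb]; split=> [ia|ic].
    by have ab' := ab ia; rewrite ab' in ia *; exact: bc.
  by have bc' := cb ic; rewrite -bc' in ic *; exact: ba.
Qed.

Lemma birkhoff_sum_nonpos (n : int) x : (forall y, X y -> 0 < r y) ->
  shift_space X -> X x -> n <= 0 -> birkhoff_sum r n x <= 0.
Proof.
move=> r0 sX Xx; case: n => [[|n]|n] // _; first by rewrite /= big_ord0.
rewrite /= oppr_le0; apply: sumr_ge0 => j _; apply/ltW/r0.
exact: shift_pow_mem.
Qed.

Lemma birkhoff_sumE (n : nat) x : birkhoff_sum r n%:Z x = bsum r x 0 n.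
Proof. by rewrite bsum0. Qed.

(** This is the Walters property for sums with a single term. *)
Lemma roof_continuous x e : shift_space X -> walters X r -> X x -> 0 < e ->
  exists m, forall y, X y -> agree m x y -> `|r x - r y| < e.
Proof.
move=> sX wr Xx e0; have [k kP] := walters_bsum sX wr e0.
exists k.+1 => y Xy xy; have := kP x y 0 0 1%N Xx Xy.
rewrite !bsum0 !big_ord1 !shift_pow0; apply=> i ik; rewrite !addr0; apply: xy; lia.
Qed.

End Susp.

Lemma half_lattice (R : realFieldType) (d : R) (z : int) :
  0 < d -> ~ `|d * z%:~R - d / 2| < d / 2.
Proof.
move=> d0; rewrite (_ : _ - _ = d * (z%:~R - 1 / 2)); last by field.
rewrite normrM (gtr0_norm d0) ltr_pM2l// ltr_distl => /andP[z1 z2].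
have : (0 < z)%R by rewrite -(ltr0z R); lra.
have : (z < 1)%R by rewrite -(ltrz1 R); lra.
lia.
Qed.

Lemma lattice_not_mixing (R : realType) (A : countType) (X : set (fullshift R A))
    (v : seq A) (r : fullshift R A -> R) (delta : R) :
  shift_space X -> synchronizing X v -> (forall x, X x -> 0 < r x) ->
  walters X r -> 0 < delta ->
  (forall p, cylinder X v p -> periodic_pt p ->
      exists m : int, \sum_(j < per p) r (shift_pow j%:Z p) = delta * m%:~R) ->
  ~ topologically_mixing X r.
Proof.
move=> sX syn r0 wr d0 dP mix.
have [y Cy] : exists y, cylinder X v y.
  case: (syn.1) => x Xx [i xi]; exists (shift_pow (i + (size v)./2%:Z) x).
  split; first exact: shift_pow_mem.
  by rewrite -[RHS]xi; apply/block_eqP => k _; rewrite /shift_pow; congr x; lia.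
have [Xy _] := Cy.
have ry0 := r0 _ Xy.
pose h := r y / 2.
(* The bound by [h / 2] keeps the box [W] off floor and roof. Two height errors and one shadowing
   error, each below [rho], add up to less than [delta / 2]. *)
have [rho [rho0 rhoh rhod]] : exists rho, [/\ 0 < rho, rho < h / 2 & rho <= delta / 10].
  exists (Num.min (h / 4) (delta / 10)); rewrite lt_min gt_min ge_min lexx orbT; split=> //.
    by apply/andP; split; rewrite /h; lra.
  by rewrite /h; apply/orP; left; lra.
have [m1 m1P] := roof_continuous sX wr Xy rho0.
have [m2 m2P] := return_time sX syn wr rho0 Cy.
pose m := maxn m1 m2.
have agm x : agree m y x -> agree m1 y x /\ agree m2 y x.
  by move=> yx; split=> i im; apply: yx; rewrite /m; lia.
pose W := [set a : set_type (under_roof X r) | agree m y (\val a).1 /\ `|h - (\val a).2| < rho].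
have WX a : W a -> X (\val a).1 by move=> _; have [] := set_mem (valP a).
have Wint a : W a -> 0 < (\val a).2 < r (\val a).1.
  move=> Wa; have Xa := WX _ Wa; case: Wa => ya; have := m1P _ Xa (agm _ ya).1.
  rewrite !ltr_distl /h => /andP[? ?] /andP[? ?].
  move: rhoh; rewrite /h => ?; apply/andP; split; lra.
have oW : open W.
  apply/open_under_roofP => a [ya ha].
  exists m, (rho - `|h - (\val a).2|); rewrite subr_gt0; split=> // b ab hab; split.
    by move=> i im; rewrite ya// ab.
  rewrite (le_lt_trans (ler_distD (\val a).2 _ _))//.
  by rewrite -ltrBrDl.
pose U := @susp_pi R A X r @` W.
(* [W] is saturated, since no gluing touches its points; hence its image is open in the quotient. *)
have UW : @susp_pi R A X r @^-1` U = W.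
  apply/seteqP; split=> [a [b Wb ba]|a Wa]; last by exists a.
  by rewrite -(susp_pi_interior (Wint _ Wb) ba).
have oU : open U by apply/open_susp_piP; rewrite UW.
have yr : under_roof X r (y, h) by split=> //=; rewrite /h; apply/andP; split; lra.
have U0 : U !=set0.
  exists (susp_pi (exist _ (y, h) (mem_set yr))); exists (exist _ (y, h) (mem_set yr)) => //.
  by split=> //=; rewrite subrr normr0.
have [T TP] := mix U U oU oU U0 U0.
pose M := (Num.truncn (`|T| / delta)).+1.
have MT : `|T| < delta * M%:R by rewrite mulrC -ltr_pdivrMr// truncnS_gt.
pose t := delta * M%:R + delta / 2.
have [b [[_ [a0 Wa0 <-] [a [b' [pa pb [n bn st]]]]]] Ub] : susp_flow_image t U `&` U !=set0.
  by apply: TP; rewrite /t; have := ler_norm T; lra.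
have Wa : W a by rewrite -UW /= pa; exists a0.
have Wb : W b' by rewrite -UW /= pb.
have [[ya ha] [yb hb]] := (Wa, Wb).
have Xa := WX _ Wa.
move: ha hb; rewrite !ltr_distl => /andP[ha1 ha2] /andP[hb1 hb2].
have M1 : 1 <= M%:R :> R by rewrite ler1n.
have dM : delta <= delta * M%:R by rewrite -[leLHS]mulr1 ler_pM2l.
(* A return with [n <= 0] would take time less than [2 * rho], while [t] exceeds [delta]. *)
have [n0|n0] := leP n 0.
  have := birkhoff_sum_nonpos r0 sX Xa n0; rewrite /t in st; lra.
case: n n0 bn st => // n n0 bn; rewrite birkhoff_sumE => st.
have [|p [Cp pn]] := m2P _ n Xa n0 (agm _ ya).2; first by rewrite -bn; exact: (agm _ yb).2.
have pp : periodic_pt p by exists n; rewrite /is_period; apply/andP; split=> //; apply/asboolP.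
have [per0 perE /(_ _ pn)/dvdnP[q nq]] := perP pp.
have [z zE] := dP p Cp pp.
rewrite [X in bsum r p 0 X]nq (bsum_mul r q perE) (bsum0 r p (per p)) zE => lt_rho.
(* The periodic orbit has length within [3 * rho] of [(M + 1/2) delta], so [delta * Z] would be too
   close to [delta / 2]. *)
pose Z : int := q%:Z * z - M%:Z.
apply: (half_lattice (z := Z) d0).
have ZE : delta * Z%:~R = q%:R * (delta * z%:~R) - delta * M%:R.
  by rewrite /Z intrB intrM !pmulrn; ring.
move: lt_rho; rewrite ZE !ltr_distl => /andP[l1 l2]; rewrite /t in st.
by apply/andP; split; lra.
Qed.

(** * Integer combinations of two positive reals *)

Lemma small_combination (R : realType) (S : set R) (a eta : R) :
  0 < a -> 0 < eta ->
  (forall d, 0 < d -> exists2 b, S b & forall z : int, b <> d * z%:~R) ->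
  exists2 b, S b & exists k l : int, 0 < k%:~R * b + l%:~R * a < eta.
Proof.
move=> a0 eta0 hS.
(* Pigeonhole on the fractional parts of j b / a for j <= K, where K > a / eta:
   two of them are close; if they were equal, then b would lie in (a / K!) Z. *)
pose K := (Num.truncn (a / eta)).+1.
have Keta : a < eta * K%:R by rewrite mulrC -ltr_pdivrMr// truncnS_gt.
have K0 : 0 < K%:R :> R by rewrite ltr0n.
have f0 : 0 < (K`!)%:R :> R by rewrite ltr0n fact_gt0.
have [b Sb bz] := hS (a / (K`!)%:R) (divr_gt0 a0 f0).
exists b => //.
pose fl (j : nat) : int := Num.floor (j%:R * b / a).
pose f (j : nat) : R := j%:R * b / a - (fl j)%:~R.
have f_itv j : 0 <= f j < 1.
  by have := floor_itv (j%:R * b / a); rewrite intrD /f /fl => /andP[? ?]; apply/andP; split; lra.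
have gK j : (Num.truncn (f j * K%:R) < K)%N.
  have /andP[fj0 fj1] := f_itv j.
  by rewrite truncn_lt_nat ?mulr_ge0 ?ler0n// -{2}[K%:R]mul1r ltr_pM2r.
pose g (j : 'I_K.+1) : 'I_K := Ordinal (gK j).
have [j1 [j2 [j12 gj]]] : exists j1 j2 : 'I_K.+1, (j1 < j2)%N /\ g j1 = g j2.
  apply: contrapT => H.
  have gi : injective g.
    move=> j1 j2 gj; apply/val_inj => /=; case: (ltngtP j1 j2) => // lt_j.
      by case: H; exists j1, j2.
    by case: H; exists j2, j1.
  by have := leq_card g gi; rewrite !card_ord ltnn.
(* Both fractional parts lie in the same bin of width [1 / K], and [a / K < eta]. *)
have close : `|f j2 - f j1| * a < eta.
  have := congr1 val gj => /= tr.
  have h j := truncn_itv (mulr_ge0 (andP (f_itv j)).1 (ltW K0)).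
  have := h j1; have := h j2; rewrite tr => /andP[u1 u2] /andP[w1 w2].
  rewrite -natr1 in u2 w2.
  have : `|f j2 - f j1| * K%:R < 1.
    rewrite -[X in _ * X](gtr0_norm K0) -normrM mulrBl ltr_norml.
    by apply/andP; split; lra.
  rewrite -(ltr_pM2r eta0) mul1r; apply: le_lt_trans.
  by rewrite -mulrA ler_wpM2l// mulrC ltW.
have fE : (f j2 - f j1) * a = (j2%:Z - j1%:Z)%:~R * b + (fl j1 - fl j2)%:~R * a.
  by rewrite /f !intrB -!pmulrn; field; rewrite gt_eqF.
have [lt_f|lt_f|eq_f] := ltgtP (f j1) (f j2).
- exists (j2%:Z - j1%:Z), (fl j1 - fl j2); rewrite -fE.
  rewrite mulr_gt0 ?subr_gt0//= (le_lt_trans _ close)//.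
  by rewrite ler_wpM2r ?ler_norm// ltW.
- exists (j1%:Z - j2%:Z), (fl j2 - fl j1).
  rewrite -[_ - _]opprB -[in X in _ + X * _]opprB !intrN !mulNr -opprD -fE -mulNr opprB.
  rewrite mulr_gt0 ?subr_gt0//= (le_lt_trans _ close)//.
  by rewrite distrC ler_wpM2r ?ler_norm// ltW.
exfalso; move: fE; rewrite eq_f subrr mul0r => /esym/eqP.
rewrite addr_eq0 -mulNr => /eqP bE.
(* Equal fractional parts make [m * b] an integer multiple of [a]. As [m] divides the factorial of
   [K], this contradicts the choice of [b]. *)
pose m := (j2 - j1)%N.
have m0 : (0 < m)%N by rewrite subn_gt0.
have mK : (m <= K)%N by have := ltn_ord j2; rewrite /m; lia.
have /dvdnP[c cE] : (m %| K`!)%N by apply: dvdn_fact; rewrite m0.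
apply: (bz (c%:Z * (fl j2 - fl j1))).
have mR : m%:R != 0 :> R by rewrite pnatr_eq0 -lt0n.
apply: (mulfI mR).
have -> : m%:R * b = (fl j2 - fl j1)%:~R * a.
  have -> : m%:R = (j2%:Z - j1%:Z)%:~R :> R by rewrite pmulrn; congr (_%:~R); rewrite /m; lia.
  by rewrite bE -intrN opprB.
rewrite cE in f0 *; rewrite natrM intrM -pmulrn; field.
by rewrite mR; have := f0; rewrite natrM => /lt0r_neq0; rewrite mulf_eq0 negb_or => /andP[].
Qed.

(** Beyond a fixed starting value, [t] is approached from below greedily: first by steps of size
    [a], then by steps of size [d = k b + l a], which is below [eta]. *)
Lemma eventually_dense (R : realType) (a b eta : R) (k l : int) (N : nat) :
  0 < a -> 0 < b -> 0 < k%:~R * b + l%:~R * a < eta ->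
  exists T, forall t, T <= t -> exists i j : nat,
    [/\ (N <= i)%N, (N <= j)%N & `|i%:R * a + j%:R * b - t| < eta].
Proof.
move=> a0 b0; set d := _ + _ => /andP[d0 deta].
pose M := (Num.truncn (a / d)).+1.
(* At most [M] small steps are made, so these reserves keep both coefficients at least [N] even if
   [k] or [l] is negative. *)
pose i0 := (N + M * `|l|)%N; pose j0 := (N + M * `|k|)%N.
exists (i0%:R * a + j0%:R * b) => t; rewrite -subr_ge0; set x := t - _ => x0.
pose q := Num.truncn (x / a).
have /andP[q1 q2] : q%:R <= x / a < q.+1%:R by apply: truncn_itv; exact/divr_ge0/ltW.
rewrite ler_pdivlMr// ltr_pdivrMr// -natr1 in q1 q2.
pose m := Num.truncn ((x - q%:R * a) / d).
have /andP[h1 h2] : m%:R <= (x - q%:R * a) / d < m.+1%:R.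
  by apply: truncn_itv; rewrite divr_ge0 ?(ltW d0)//; lra.
have mM : (m <= M)%N.
  rewrite /m /M; apply/leqW/le_truncn; rewrite ler_pM2r ?invr_gt0//; lra.
rewrite ler_pdivlMr// ltr_pdivrMr// -natr1 in h1 h2.
have nat_ge (z : int) : N%:Z <= z -> exists2 n : nat, (N <= n)%N & z = n%:Z.
  by move=> Nz; exists `|z|%N; lia.
have [i Ni iE] : exists2 i : nat, (N <= i)%N & i0%:Z + q%:Z + m%:Z * l = i%:Z.
  apply: nat_ge; rewrite /i0; clear -mM; nia.
have [j Nj jE] : exists2 j : nat, (N <= j)%N & j0%:Z + m%:Z * k = j%:Z.
  apply: nat_ge; rewrite /j0; clear -mM; nia.
exists i, j; split=> //.
rewrite [i%:R]pmulrn [j%:R]pmulrn -iE -jE !(intrD, intrM) -!pmulrn.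
rewrite (_ : _ - t = - (x - q%:R * a - m%:R * d)); last by rewrite /x /d; ring.
by rewrite normrN ger0_norm; lra.
Qed.

(** * Non-lattice periods force mixing *)

Section Connect.
Context {R : realType} {A : countType}.
Implicit Types (x y z p q : fullshift R A) (X : set (fullshift R A)).
Implicit Types (r : fullshift R A -> R) (u v w : seq A).

(** The periodic point [p] also shows [v] at [- n]. Recentering there leaves [v] at 0, ready for
    another splice in front. *)
Lemma prepend_cylinder X v p z n : shift_space X -> synchronizing X v ->
  cylinder X v p -> cylinder X v z -> shift_pow n%:Z p = p ->
  cylinder X v (shift_pow (- n%:Z) (splice p z)).
Proof.
move=> sX syn Cp Cz pn; have [Xs _] := splice_cylinder sX syn Cp Cz.
apply: cylinder_ext (Cp) _ _; first exact: shift_pow_mem.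
move=> i iv; rewrite /shift_pow (spliceE _ Cp Cz).1; last by lia.
by rewrite -[in LHS]pn /shift_pow subrK.
Qed.

(* The orbit w follows a, then p for P + 2K steps, then q for Q + 2L steps,
   then c. The margins K, L > k allow its five pieces to be compared with the
   orbits a|p, p, p|q, q, q|c, and only the pieces along p and q depend on
   P and Q. *)
Lemma connecting_orbit X v r (e : R) (k : nat) (a p q c : fullshift R A) (m1 m3 K L P Q : nat) :
  shift_space X -> synchronizing X v ->
  (forall x y s t n, X x -> X y ->
    (forall i : int, - k%:Z <= i <= (n + k)%N%:Z -> x (i + s) = y (i + t)) ->
    `|bsum r x s n - bsum r y t n| < e) ->
  cylinder X v a -> cylinder X v p -> cylinder X v q -> cylinder X v c ->
  (k < K)%N -> (k < L)%N ->
  shift_pow K%:Z p = p -> shift_pow P%:Z p = p ->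
  shift_pow L%:Z q = q -> shift_pow Q%:Z q = q ->
  exists (w : fullshift R A) (n : nat), [/\ X w, forall i : int, i < m1%:Z -> w i = a (i - m1%:Z),
    forall i : int, - m3%:Z <= i -> w (i + n%:Z) = c (i + m3%:Z) &
    `|bsum r w 0 n - (bsum r (splice a p) (- m1%:Z) (m1 + K) +
       bsum r (splice p q) (- K%:Z) (K + L) +
       bsum r (splice q c) (- L%:Z) (L + m3) +
       bsum r p 0 P + bsum r q 0 Q)| < 5 * e].
Proof.
move=> sX syn kP Ca Cp Cq Cc kK kL pK pP qL qQ.
have per_eq x (n : nat) (i : int) : shift_pow n%:Z x = x -> x (i + n%:Z) = x i.
  by move=> xn; rewrite -[in RHS]xn.
have pPK : shift_pow (P + K + K)%N%:Z p = p by rewrite !PoszD -!shift_powD !(pK, pP).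
have qQL : shift_pow (Q + L + L)%N%:Z q = q by rewrite !PoszD -!shift_powD !(qL, qQ).
(* The orbit is built from its end: [q] in front of [c], then [p], and finally [a]. *)
have Cq' := prepend_cylinder sX syn Cq Cc qQL.
have Cp' := prepend_cylinder sX syn Cp Cq' pPK.
set zq := shift_pow _ _ in Cq' Cp'; set zp := shift_pow _ _ in Cp'.
have [Xs _] := splice_cylinder sX syn Ca Cp'.
have [Xap _] := splice_cylinder sX syn Ca Cp.
have [Xpq _] := splice_cylinder sX syn Cp Cq.
have [Xqc _] := splice_cylinder sX syn Cq Cc.
have [Xp _] := Cp; have [Xq _] := Cq.
pose w := shift_pow (- m1%:Z) (splice a zp).
have Xw : X w by exact: shift_pow_mem.
pose n1 : int := m1%:Z + (P + K + K)%N%:Z; pose n2 := n1 + (Q + L + L)%N%:Z.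
have w1 (i : int) : i < m1%:Z -> w i = a (i - m1%:Z).
  by move=> i1; rewrite /w /shift_pow /splice ifT//; lia.
have w2 (i : int) : m1%:Z <= i < n1 -> w i = p (i - m1%:Z).
  move=> i1; rewrite /w /shift_pow /splice ifF; last by lia.
  rewrite /zp /shift_pow /splice ifT; last by rewrite /n1 in i1; lia.
  by rewrite -(per_eq _ _ _ pPK) subrK.
have w3 (i : int) : n1 <= i < n2 -> w i = q (i - n1).
  move=> i1; rewrite /w /shift_pow /splice ifF; last by rewrite /n1 in i1; lia.
  rewrite /zp /shift_pow /splice ifF; last by rewrite /n1 in i1; lia.
  rewrite /zq /shift_pow /splice ifT; last by rewrite /n2 /n1 in i1; lia.
  by rewrite -(per_eq _ _ _ qQL) subrK; congr q; rewrite /n1; lia.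
have w4 (i : int) : n2 <= i -> w i = c (i - n2).
  move=> i1; rewrite /w /shift_pow /splice ifF; last by rewrite /n2 /n1 in i1; lia.
  rewrite /zp /shift_pow /splice ifF; last by rewrite /n2 /n1 in i1; lia.
  rewrite /zq /shift_pow /splice ifF; last by rewrite /n2 /n1 in i1; lia.
  by congr c; rewrite /n2 /n1; lia.
clearbody w; clear zp zq Cq' Cp' Xs.
exists w, ((m1 + K) + (P + ((K + L) + (Q + (L + m3)))))%N; split=> //.
  move=> i im; rewrite w4; last by rewrite /n2 /n1; lia.
  by congr c; rewrite /n2 /n1; lia.
have per_add x (n : nat) (i : int) : shift_pow n%:Z x = x -> x (n%:Z + i) = x i.
  by rewrite addrC; exact: per_eq.
have h1 : `|bsum r w 0 (m1 + K) - bsum r (splice a p) (- m1%:Z) (m1 + K)| < e.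
  apply: kP => // i ik; rewrite addr0; have [im|im] := ltP i m1%:Z.
    by rewrite w1// /splice ifT//; lia.
  by rewrite w2 /splice ?ifF//; rewrite ?/n1; lia.
(* This piece starts [K] steps into the stretch along [p]; as [K] is a period of [p], the phase is 0
   again. *)
have h2 : `|bsum r w (0 + (m1 + K)%N%:Z) P - bsum r p 0 P| < e.
  apply: kP => // i ik; rewrite w2; last by rewrite /n1; lia.
  by rewrite -(per_add _ _ (i + 0) pK); congr p; lia.
have h3 : `|bsum r w (0 + (m1 + K)%N%:Z + P%:Z) (K + L) -
            bsum r (splice p q) (- K%:Z) (K + L)| < e.
  apply: kP => // i ik; rewrite /splice; case: ifPn => iK.
    rewrite w2; last by rewrite /n1; lia.
    by rewrite -(per_add _ _ (i + _) pPK); congr p; lia.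
  rewrite w3; last by rewrite /n2 /n1; lia.
  by congr q; rewrite /n1; lia.
have h4 : `|bsum r w (0 + (m1 + K)%N%:Z + P%:Z + (K + L)%N%:Z) Q - bsum r q 0 Q| < e.
  apply: kP => // i ik; rewrite w3; last by rewrite /n2 /n1; lia.
  by rewrite -(per_add _ _ (i + 0) qL); congr q; rewrite /n1; lia.
have h5 : `|bsum r w (0 + (m1 + K)%N%:Z + P%:Z + (K + L)%N%:Z + Q%:Z) (L + m3) -
            bsum r (splice q c) (- L%:Z) (L + m3)| < e.
  apply: kP => // i ik; rewrite /splice; case: ifPn => iL.
    rewrite w3; last by rewrite /n2 /n1; lia.
    by rewrite -(per_add _ _ (i + _) qQL); congr q; rewrite /n1; lia.
  rewrite w4; last by rewrite /n2 /n1; lia.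
  by congr c; rewrite /n2 /n1; lia.
rewrite (bsumD r w _ (m1 + K)) (bsumD r w _ P) (bsumD r w _ (K + L)) (bsumD r w _ Q).
move: h1 h2 h3 h4 h5; do 10 move: (bsum _ _ _ _) => ?.
rewrite !ltr_distl => /andP[? ?] /andP[? ?] /andP[? ?] /andP[? ?] /andP[? ?].
by apply/andP; split; lra.
Qed.

Lemma block_cat_eq x (i : int) w1 w2 :
  block x i (size (w1 ++ w2)) = w1 ++ w2 ->
  block x i (size w1) = w1 /\ block x (i + (size w1)%:Z) (size w2) = w2.
Proof.
rewrite size_cat block_cat => /eqP; rewrite eqseq_cat ?size_block//.
by move=> /andP[/eqP-> /eqP->].
Qed.

(** Transitivity links the central block of [x] to [v] inside a point of [X], which is then centered
    at [v]. With [m < n] the copy of that block lies at negative coordinates, where a later splice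
    preserves it. *)
Lemma reach_synchronizing X v x m : shift_space X -> transitive_shift X ->
  language X v -> X x ->
  exists2 a, cylinder X v a & exists2 n : nat, (m < n)%N &
    forall i : int, (`|i| <= m)%N -> a (i - n%:Z) = x i.
Proof.
move=> sX tX Lv Xx; pose u := block x (- m%:Z) m.*2.+1.
have [w _ [z Xz [i zi]]] := tX u v (language_block _ _ Xx) Lv.
have [zu /block_cat_eq[_ zv]] := block_cat_eq zi.
rewrite size_block in zu zv.
pose h := (size v)./2.
exists (shift_pow (i + m.*2.+1%:Z + (size w)%:Z + h%:Z) z).
  split; first exact: shift_pow_mem.
  by rewrite -[RHS]zv; apply/block_eqP => k _; rewrite /shift_pow; congr z; lia.
exists (h + size w + m.+1)%N; first by lia.
move=> j jm; move: zu => /block_eqP/(_ `|(j + m%:Z)%R|%N) zu.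
have jE : - m%:Z + `|(j + m%:Z)%R|%N%:Z = j by lia.
rewrite -[in RHS]jE -zu; last by lia.
by rewrite /shift_pow; congr z; lia.
Qed.

Lemma leave_synchronizing X v x m : shift_space X -> transitive_shift X ->
  language X v -> X x ->
  exists2 a, cylinder X v a & exists2 n : nat, (m <= n)%N &
    forall i : int, (`|i| <= m)%N -> a (i + n%:Z) = x i.
Proof.
move=> sX tX Lv Xx; pose u := block x (- m%:Z) m.*2.+1.
have [w _ [z Xz [i zi]]] := tX v u Lv (language_block _ _ Xx).
have [zv /block_cat_eq[_ zu]] := block_cat_eq zi.
rewrite size_block in zu.
pose h := (size v)./2.
exists (shift_pow (i + h%:Z) z).
  split; first exact: shift_pow_mem.
  by rewrite -[RHS]zv; apply/block_eqP => k _; rewrite /shift_pow; congr z; lia.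
exists (size v - h + size w + m)%N; first by lia.
move=> j jm; move: zu => /block_eqP/(_ `|(j + m%:Z)%R|%N) zu.
have jE : - m%:Z + `|(j + m%:Z)%R|%N%:Z = j by lia.
rewrite -[in RHS]jE -zu; last by lia.
by rewrite /shift_pow; congr z; rewrite /h; lia.
Qed.

(** A point of [U] may lie on the floor or the roof; its height is moved inward so that a whole
    product box fits under the roof. *)
Lemma open_susp_box X r (U : set (suspension X r)) : shift_space X -> walters X r ->
  (forall x, X x -> 0 < r x) -> open U -> U !=set0 ->
  exists x (s : R) m (e : R), [/\ X x, 0 < e & forall y t, X y -> agree m x y -> `|s - t| < e ->
    exists2 b : set_type (under_roof X r), \val b = (y, t) & U (susp_pi b)].
Proof.
move=> sX wr r0 oU [b0 Ub0].
pose a : set_type (under_roof X r) := repr b0.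
have Ua : U (susp_pi a) by rewrite /susp_pi /a reprK.
have [m0 [e0 [e0_gt0 aU]]] := (open_under_roofP _).1 oU a Ua.
have [Xx /andP[s0 sr]] := set_mem (valP a).
move: (\val a).1 (\val a).2 aU Xx s0 sr => x s aU Xx s0 sr.
have rx := r0 _ Xx.
pose e := Num.min (e0 / 4) (r x / 8).
have [e_gt0 ee0 er] : [/\ 0 < e, e <= e0 / 4 & e <= r x / 8].
  rewrite lt_min !ge_min !lexx orbT; split=> //.
  by apply/andP; split; lra.
have [m1 m1P] := roof_continuous sX wr Xx e_gt0.
have [t0 t0P] : exists t0, forall t, `|t0 - t| < e ->
    [/\ 0 <= t, t <= r x - e & `|s - t| < e0].
  (* The move is upward in the lower half and downward in the upper half. The margin [e] below [r x]
     absorbs the variation of the roof over nearby points. *)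
  have [sle|slt] := leP s (r x / 2).
    exists (s + e) => t; rewrite !ltr_distl => /andP[? ?]; split; [lra|lra|].
    by apply/andP; split; lra.
  exists (s - 2 * e) => t; rewrite !ltr_distl => /andP[? ?]; split; [lra|lra|].
  by apply/andP; split; lra.
exists x, t0, (maxn m0 m1), e; split=> // y t Xy xy /t0P[t_ge t_le st].
have := m1P y Xy (fun i im => xy i (leq_trans im (leq_maxr _ _))).
rewrite ltr_distl => /andP[ry1 ry2].
have yt : under_roof X r (y, t) by split=> //=; apply/andP; split; lra.
exists (exist _ (y, t) (mem_set yt)) => //; apply: aU => //=.
by move=> i im; apply: xy; rewrite leq_max im.
Qed.

Lemma non_lattice_mixing X v r : shift_space X -> transitive_shift X ->
  synchronizing X v -> (forall x, X x -> 0 < r x) -> walters X r ->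
  (forall d, 0 < d -> exists p, [/\ cylinder X v p, periodic_pt p &
     forall z : int, \sum_(j < per p) r (shift_pow j%:Z p) <> d * z%:~R]) ->
  topologically_mixing X r.
Proof.
move=> sX tX syn r0 wr hS U V oU oV U0 V0.
have [x [sx [mx [ex [Xx ex0 xU]]]]] := open_susp_box sX wr r0 oU U0.
have [y [sy [my [ey [Xy ey0 yV]]]]] := open_susp_box sX wr r0 oV V0.
have [a Ca [m1 mx1 ax]] := reach_synchronizing mx sX tX syn.1 Xx.
have [c Cc [m3 my3 cy]] := leave_synchronizing my sX tX syn.1 Xy.
(* Any periodic point through [v] will do, so the value 1 is arbitrary. *)
have [p [Cp pp _]] := hS 1 ltr01.
have sum_gt0 q : cylinder X v q -> periodic_pt q -> 0 < bsum r q 0 (per q).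
  move=> [Xq _] /perP[q0 _ _]; rewrite bsum0.
  case: (per q) q0 => // n _; rewrite big_ord_recl.
  apply: ltr_pwDl; first by apply: r0; apply: shift_pow_mem.
  by apply: sumr_ge0 => j _; apply/ltW/r0; apply: shift_pow_mem.
have [d /hS[q [Cq pq qd]]|_ [q [Cq pq ->]] [k [l klP]]] := @small_combination R
    [set b | exists q, [/\ cylinder X v q, periodic_pt q & b = bsum r q 0 (per q)]]
    (bsum r p 0 (per p)) (ey / 2) (sum_gt0 _ Cp pp) (divr_gt0 ey0 (ltr0Sn _ _)).
  by exists (bsum r q 0 (per q)); [exists q | rewrite bsum0].
have [n0 pn _] := perP pp; have [n0' qn _] := perP pq.
(* Five Walters errors of [ey / 10] and the density error [ey / 2] together stay below [ey]. *)
have ey10 : 0 < ey / 10 by lra.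
have [M MP] := walters_bsum sX wr ey10.
pose K := (M.+1 * per p)%N; pose L := (M.+1 * per q)%N.
have MK : (M < K)%N by rewrite /K; nia.
have ML : (M < L)%N by rewrite /L; nia.
have pmul j : shift_pow (j * per p)%N%:Z p = p by rewrite PoszM shift_pow_mul.
have qmul j : shift_pow (j * per q)%N%:Z q = q by rewrite PoszM shift_pow_mul.
have [T TP] := eventually_dense 0 (sum_gt0 _ Cp pp) (sum_gt0 _ Cq pq) klP.
pose C := bsum r (splice a p) (- m1%:Z) (m1 + K) +
       bsum r (splice p q) (- K%:Z) (K + L) +
       bsum r (splice q c) (- L%:Z) (L + m3).
exists (T + C + sy - sx) => t tT.
have [|i [j [_ _ ijt]]] := TP (t + sx - sy - C); first by lra.
have [w [n [Xw wa wc]]] := connecting_orbit m1 m3 sX syn MP Ca Cp Cq Cc MK ML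
  (pmul _) (pmul i) (qmul _) (qmul j).
rewrite !bsum_mul// -/C => wS.
have [b1 b1E Ub1] : exists2 b : set_type (under_roof X r), \val b = (w, sx) & U (susp_pi b).
  apply: xU => //; last by rewrite subrr normr0.
  by move=> u um; rewrite wa ?ax//; lia.
(* The height in [V] is taken to be exactly the time left over, so the flow time is [t] itself and
   all errors go into the height. *)
have [b2 b2E Vb2] : exists2 b : set_type (under_roof X r),
    \val b = (shift_pow n%:Z w, t + sx - bsum r w 0 n) & V (susp_pi b).
  apply: yV; first exact: shift_pow_mem.
    by move=> u um; rewrite /shift_pow wc ?cy//; lia.
  move: wS ijt; rewrite !ltr_distl => /andP[? ?] /andP[? ?].
  by apply/andP; split; lra.
exists (susp_pi b2); split=> //; exists (susp_pi b1) => //.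
exists b1, b2; split=> //; exists n%:Z; rewrite b1E b2E//=.
by rewrite -bsum0 addrC subrK.
Qed.

End Connect.

Theorem theorem3p1 (R : realType) (A : countType) (X : set (fullshift R A))
    (v : seq A) (r : fullshift R A -> R)
    (hX : shift_space X) (hT : transitive_shift X) (hv : synchronizing X v)
    (r_gt0 : forall x, X x -> 0 < r x) (hr : walters X r) :
  ~ topologically_mixing X r <->
  exists2 delta : R, 0 < delta &
    forall p, cylinder X v p -> periodic_pt p ->
      exists m : int,
        \sum_(j < per p) r (shift_pow j%:Z p) = delta * m%:~R.
Proof.
split=> [nmix|[delta d0 dP]]; last exact: lattice_not_mixing dP.
apply: contrapT => nd; apply: nmix.
apply: (non_lattice_mixing hX hT hv r_gt0 hr) => d d0.
apply: contrapT => H; apply: nd; exists d => // p Cp pp.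
apply: contrapT => nz; apply: H; exists p; split=> // z zE.
by apply: nz; exists z.
Qed.
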